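(* Let $k,q$ be positive integers and let $G$ be a finite simple graph whose induced subgraph on the set of all vertices of degree (in $G$) larger than $k$ is not $q$-solvable. Then $\mathrm{HG}(G)<e\,k^2q^k$, where $e$ is the base of the natural logarithm.
   Context: Let $G$ be a finite simple graph with vertices $v_1,\ldots,v_n$ and let $[q]=\{1,\ldots,q\}$ be a set of $q$ colors. A coloring is any $x\in[q]^n$, where $x_i$ is the color of $v_i$. A guessing strategy is a choice, for each $i$, of a function $f_i$ with values in $[q]$ depending only on the colors of the neighbors of $v_i$; vertex $v_i$ guesses correctly on $x$ if $f_i(x)=x_i$. $G$ is $q$-solvable if there is a guessing strategy such that for every coloring $x\in[q]^n$ at least one vertex guesses correctly (in particular, the graph with no vertices is not $q$-solvable). For $G$ with at least one vertex, the hat guessing number $\mathrm{HG}(G)$ is the largest positive integer $q$ such that $G$ is $q$-solvable. *)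

(* Defs.v *)
From HB Require Import structures.
From mathcomp Require Import all_boot.
Set Implicit Arguments.
Unset Strict Implicit.
Unset Printing Implicit Defensive.

Record sgraph := SGraph {
  vertex :> finType;
  adj : rel vertex;
  adj_sym : symmetric adj;
  adj_irrefl : irreflexive adj
}.

Definition degree (G : sgraph) (v : G) : nat := #|[set w | adj v w]|.

Section Induced.
Variables (G : sgraph) (A : {set G}).

Definition induced_adj : rel {v : G | v \in A} := relpre val (@adj G).

Lemma induced_sym : symmetric induced_adj.
Proof. by move=> u v; apply: adj_sym. Qed.

Lemma induced_irrefl : irreflexive induced_adj.
Proof. by move=> u; apply: adj_irrefl. Qed.

Definition induced : sgraph := SGraph induced_sym induced_irrefl.

End Induced.

Section HatGuessing.
Variable G : sgraph.

Definition coloring (q : nat) := {ffun G -> 'I_q}.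

(* Guesses are functions of the whole coloring; [is_strategy] restricts them  *)
(* to depend only on the colors of the neighbors of the guessing vertex.      *)
Definition is_strategy q (f : {ffun G -> {ffun coloring q -> 'I_q}}) : bool :=
  [forall v, forall x : coloring q, forall y : coloring q,
     [forall w, adj v w ==> (x w == y w)] ==> (f v x == f v y)].

Definition solvable (q : nat) : bool :=
  [exists f : {ffun G -> {ffun coloring q -> 'I_q}},
     is_strategy f && [forall x : coloring q, exists v, f v x == x v]].

(* Each vertex is right on a fraction 1 / q of the colorings. *)
Lemma solvable_leq q : (0 < q) && solvable q -> q <= #|G|.
Proof.
case/andP=> q_gt0 /existsP[f /andP[/forallP f_loc /forallP f_win]].
pose C v := [set x : coloring q | f v x == x v].
pose upd v (p : coloring q * 'I_q) : coloring q :=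
  [ffun w => if w == v then p.2 else p.1 w].
have cardC v : #|C v| * q <= q ^ #|G|.
  have -> : #|C v| * q = #|setX (C v) [set: 'I_q]|.
    by rewrite cardsX cardsT card_ord.
  have -> : q ^ #|G| = #|{: coloring q}| by rewrite card_ffun card_ord.
  rewrite -(@card_in_imset _ _ (upd v)); first exact: max_card.
  have updE p : p.1 \in C v -> f v (upd v p) = p.1 v.
    rewrite inE => /eqP fC; rewrite -[RHS]fC; apply/eqP.
    move/forallP/(_ (upd v p))/forallP/(_ p.1)/implyP: (f_loc v); apply.
    apply/forallP=> w; rewrite ffunE; case: (eqVneq w v) => [->|_].
      by rewrite adj_irrefl.
    by rewrite eqxx implybT.
  move=> p1 p2; rewrite ![_ \in setX _ _]inE.
  move=> /andP[p1C _] /andP[p2C _] eq_upd.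
  have eqw w : upd v p1 w = upd v p2 w by rewrite eq_upd.
  have eq1 : p1.1 = p2.1.
    apply/ffunP=> w; case: (eqVneq w v) => [->|/negPf w'v].
      by rewrite -updE // eq_upd updE.
    by have := eqw w; rewrite !ffunE w'v.
  have eq2 : p1.2 = p2.2 by have := eqw v; rewrite !ffunE eqxx.
  by case: p1 p2 eq1 eq2 {p1C p2C eq_upd eqw} => [? ?] [? ?] /= -> ->.
have cover : q ^ #|G| <= \sum_(v : G) #|C v|.
  have <- : #|{: coloring q}| = q ^ #|G| by rewrite card_ffun card_ord.
  rewrite -sum1_card; under [X in _ <= X]eq_bigr do rewrite -sum1dep_card.
  rewrite (exchange_big_dep xpredT) //=; apply: leq_sum => x _.
  have /existsP[v fv] := f_win x.
  by rewrite (bigD1 v) ?inE.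
have qn_gt0 : 0 < q ^ #|G| by rewrite expn_gt0 q_gt0.
rewrite -(leq_pmul2r qn_gt0) [q * _]mulnC.
apply: (leq_trans (leq_mul cover (leqnn q))).
rewrite big_distrl /= -sum_nat_const; exact: leq_sum.
Qed.

Lemma ex_solvable : 0 < #|G| -> exists q, (0 < q) && solvable q.
Proof.
case/card_gt0P=> v _; exists 1; apply/existsP.
exists [ffun=> [ffun=> ord0]]; apply/andP; split.
  by do 3!apply/forallP=> ?; apply/implyP=> _; rewrite !ffunE.
by apply/forallP=> x; apply/existsP; exists v; rewrite !ffunE [x v]ord1.
Qed.

Definition HG (G_gt0 : 0 < #|G|) : nat :=
  ex_maxn (ex_solvable G_gt0) solvable_leq.

Lemma HGP (G_gt0 : 0 < #|G|) :
  [/\ 0 < HG G_gt0, solvable (HG G_gt0) &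
      forall q, 0 < q -> solvable q -> q <= HG G_gt0].
Proof.
rewrite /HG; case: ex_maxnP => q /andP[q_gt0 q_sol] q_max.
by split=> // p p_gt0 p_sol; apply: q_max; rewrite p_gt0.
Qed.

End HatGuessing.

(* Main.v *)
Require Import Defs.
From mathcomp Require Import all_boot all_order all_algebra.
From mathcomp Require Import reals sequences exp.
Set Implicit Arguments.
Unset Strict Implicit.
Unset Printing Implicit Defensive.

(** Suppose that G is N-solvable through the guesses f, with N at least
    e k^2 q^k.  Let S be the set of vertices of degree larger than k, and L
    its complement.  Vertices of S are only ever given one of q colors.

    Once the colors x on L are fixed, the guesses on S amount to a strategy on
    the subgraph induced by S with q colors, and some coloring z of S defeats
    it.  It remains to choose x so that the vertices of L are wrong whatever
    the coloring z of S turns out to be.  Call v in L unsafe for x when x v is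
    among the guesses that v could make as z varies; since v has at most k
    neighbors, there are at most q^k such guesses, and they do not depend on
    x v.  Hence v is unsafe with probability at most q^k / N, even when all
    the colors other than that of v are known.  In particular this bound
    survives conditioning on the safety of any set of vertices that are
    neither v nor adjacent to v, because their safety does not involve x v.

    This is the setting of the lopsided local lemma for a graph of maximum
    degree at most k, which gives an x for which all of L is safe as soon as
    q^k (k + 1)^k < N k^(k - 1); this follows from (1 + 1 / k)^k < e.  The
    local lemma is proved by counting, in [lopsided_local_lemma]; the
    conditional bound is [card_resample]; the two halves of the argument are
    joined in [not_solvable_of_high_degree]. *)

(** * A counting form of the lopsided local lemma *)

Section LocalLemma.
Variables (X V : finType) (E : V -> {set X}) (e : rel V) (L : {set V}).
Variables (k m N : nat).

Definition avoid (T : {set V}) : {set X} := ~: \bigcup_(v in T) E v.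

Lemma avoidP (T : {set V}) x :
  reflect (forall v, v \in T -> x \notin E v) (x \in avoid T).
Proof.
rewrite inE; apply: (iffP idP) => [xT v vT | xT].
  by apply: contra xT => xv; apply/bigcupP; exists v.
by apply/negP => /bigcupP[v vT]; apply/negP/xT.
Qed.

Lemma avoidS (T U : {set V}) : T \subset U -> avoid U \subset avoid T.
Proof.
move=> /subsetP TU; apply/subsetP=> x /avoidP xU.
by apply/avoidP=> v /TU /xU.
Qed.

Lemma card_avoidU1 (T : {set V}) v :
  #|avoid T| = #|avoid T :&: E v| + #|avoid (v |: T)|.
Proof.
rewrite -(cardsID (E v) (avoid T)); congr (_ + #|pred_of_set _|).
by rewrite /avoid bigcup_setU big_set1 setCU setDE setIC.
Qed.

Hypothesis e_sym : symmetric e.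
Hypothesis deg_le : forall v, v \in L -> #|L :&: [set w | e v w]| <= k.
Hypothesis k_gt0 : 0 < k.
Hypothesis threshold : m * k.+1 ^ k < N * k ^ k.-1.
Hypothesis lopsided : forall v (B : {set V}), v \in L -> B \subset L ->
  v \notin B -> (forall w, w \in B -> ~~ e v w) ->
  N * #|avoid B :&: E v| <= m * #|avoid B|.

(** Making one more vertex safe divides the count by at most (k + 1) / k.  The
    condition that fewer than k neighbors of [v] lie in [T] makes the bad
    proportion at most (m / N) ((k + 1) / k)^(k - 1); this is where the
    exponent k - 1 of the threshold comes from. *)
Let gentle (T : {set V}) := forall v, v \in L -> v \notin T ->
  #|T :&: [set w | e v w]| < k -> k * #|avoid T| <= k.+1 * #|avoid (v |: T)|.

(** Put the elements of [U] back one at a time: each of them has the neighbor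
    [v] in [L] but never in the current set, so at most k - 1 of its neighbors
    are there and [gentle] applies. *)
Let card_avoidD (T U : {set V}) v : v \in L -> T \subset L -> v \notin T ->
  (forall T' : {set V}, T' \subset L -> #|T'| < #|T| -> gentle T') ->
  U \subset T :&: [set w | e v w] ->
  k ^ #|U| * #|avoid (T :\: U)| <= k.+1 ^ #|U| * #|avoid T|.
Proof.
move=> vL TL vT IH.
have [n] := ubnP #|U|; elim: n U => // n IHn U Un UT.
have [->|[u uU]] := set_0Vmem U; first by rewrite cards0 setD0.
have /subsetP UT' := UT.
have /setIP[uT] := UT' u uU; rewrite inE => evu.
have uL : u \in L by apply: (subsetP TL).
have cardU := cardsD1 u U; rewrite uU add1n in cardU.
have back : T :\: (U :\ u) = u |: (T :\: U).
  by apply/setP=> w; rewrite !inE; case: (eqVneq w u) => [->|] //=.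
have := IHn (U :\ u).
rewrite -ltnS -cardU => /(_ Un (subset_trans (subD1set _ _) UT)).
rewrite back => IHU.
have TUL : T :\: U \subset L by apply: subset_trans TL; apply: subsetDl.
have smaller : #|T :\: U| < #|T|.
  apply: proper_card; apply/properP; split; first exact: subsetDl.
  by exists u => //; rewrite inE uU.
have free : #|(T :\: U) :&: [set w | e u w]| < k.
  apply: leq_trans (deg_le uL); apply: proper_card; apply/properP; split.
    exact: setSI.
  exists v; first by rewrite !inE vL e_sym.
  by rewrite !inE (negPf vT) andbF.
have uTU : u \notin T :\: U by rewrite inE uU.
have step := IH _ TUL smaller u uL uTU free.
rewrite cardU !expnS.
rewrite [k * _]mulnC -mulnA; apply: leq_trans (leq_mul (leqnn _) step) _.
by rewrite mulnCA -mulnA leq_mul2l IHU orbT.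
Qed.

(** Forgetting the safety of the neighbors of [v] brings the bad event under
    [lopsided]; restoring it costs (k + 1) / k per neighbor in [T]. *)
Let card_avoid_bad (T : {set V}) v : v \in L -> T \subset L -> v \notin T ->
  (forall T' : {set V}, T' \subset L -> #|T'| < #|T| -> gentle T') ->
  N * k ^ #|T :&: [set w | e v w]| * #|avoid T :&: E v|
    <= m * k.+1 ^ #|T :&: [set w | e v w]| * #|avoid T|.
Proof.
move=> vL TL vT IH.
set r := #|T :&: [set w | e v w]|.
set B := T :\: (T :&: [set w | e v w]).
have le1 : #|avoid T :&: E v| <= #|avoid B :&: E v|.
  by apply/subset_leq_card/setSI/avoidS/subsetDl.
have le2 := card_avoidD vL TL vT IH (subxx _).
have le3 : N * #|avoid B :&: E v| <= m * #|avoid B|.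
  apply: lopsided => //.
  - by apply: subset_trans TL; apply: subsetDl.
  - by rewrite inE (negPf vT) andbF.
  - by move=> w; rewrite !inE negb_and; case: (w \in T); rewrite ?andbT ?andbF.
rewrite -[N * _ * _]mulnA -[m * _ * _]mulnA.
apply: (@leq_trans (k ^ r * (N * #|avoid B :&: E v|))).
  by rewrite mulnCA !leq_mul2l le1 !orbT.
apply: leq_trans (leq_mul (leqnn _) le3) _.
by rewrite mulnCA leq_mul2l le2 orbT.
Qed.

Let pad r s a b : r <= s ->
  N * k ^ r * a <= m * k.+1 ^ r * b -> N * k ^ s * a <= m * k.+1 ^ s * b.
Proof.
move=> rs le_ab; rewrite -(subnK rs) !expnD.
have -> : N * (k ^ (s - r) * k ^ r) * a = k ^ (s - r) * (N * k ^ r * a).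
  by rewrite -!mulnA mulnCA.
have -> : m * (k.+1 ^ (s - r) * k.+1 ^ r) * b
          = k.+1 ^ (s - r) * (m * k.+1 ^ r * b).
  by rewrite -!mulnA mulnCA.
apply: leq_mul => //.
by case: (posnP (s - r)) => [-> // | sr_gt0]; rewrite leq_exp2r.
Qed.

Let gap_gt0 : 0 < N * k ^ k.-1.
Proof. exact: leq_ltn_trans threshold. Qed.

Let gentle_all (T : {set V}) : T \subset L -> gentle T.
Proof.
have [n] := ubnP #|T|; elim: n T => // n IHn T Tn TL v vL vT free.
have IH (T' : {set V}) : T' \subset L -> #|T'| < #|T| -> gentle T'.
  by move=> T'L T'T; apply: IHn => //; apply: leq_trans T'T _.
have bad := card_avoid_bad vL TL vT IH.
have {bad} : N * k ^ k.-1 * #|avoid T :&: E v|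
             <= m * k.+1 ^ k.-1 * #|avoid T|.
  by apply: pad bad; rewrite -ltnS prednK.
move/(leq_mul (leqnn k.+1)).
have -> : k.+1 * (m * k.+1 ^ k.-1 * #|avoid T|) = m * k.+1 ^ k * #|avoid T|.
  have -> : k.+1 ^ k = k.+1 * k.+1 ^ k.-1 by rewrite -expnS prednK.
  by rewrite -!mulnA mulnCA.
move=> bad; have {bad} := leq_trans bad (leq_mul (ltnW threshold) (leqnn _)).
rewrite mulnCA leq_pmul2l // => bad.
rewrite -(leq_add2l (k.+1 * #|avoid T :&: E v|)) -mulnDr -card_avoidU1 mulSn.
by rewrite leq_add2r.
Qed.

(** A vertex added last may find all k slots taken, and then the lost
    proportion is only known to be below 1 / k instead of 1 / (k + 1).  This is
    enough for something to be left, and non-emptiness is all that the next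
    step of this induction uses, since the losses on its smaller sets come
    from [gentle_all]. *)
Lemma lopsided_local_lemma : 0 < #|X| -> exists x, x \in avoid L.
Proof.
move=> X_gt0; suff: 0 < #|avoid L| by case/card_gt0P=> x; exists x.
suff pos (T : {set V}) : T \subset L -> 0 < #|avoid T| by exact: pos.
have [n] := ubnP #|T|; elim: n T => // n IHn T Tn TL.
have [->|[v vT]] := set_0Vmem T; first by rewrite /avoid big_set0 setC0 cardsT.
have vL : v \in L by apply: (subsetP TL).
have TvL : T :\ v \subset L by apply: subset_trans TL; apply: subD1set.
have Tv_gt0 : 0 < #|avoid (T :\ v)|.
  by apply: IHn => //; move: Tn; rewrite (cardsD1 v T) vT.
have vTv : v \notin T :\ v by rewrite !inE eqxx.
have bad := card_avoid_bad vL TvL vTv (fun T' T'L _ => gentle_all T'L).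
have {bad} : N * k ^ k * #|avoid (T :\ v) :&: E v|
             <= m * k.+1 ^ k * #|avoid (T :\ v)|.
  apply: pad bad; apply: leq_trans (deg_le vL).
  exact/subset_leq_card/setSI.
move=> bad.
have : N * k ^ k.-1 * (k * #|avoid (T :\ v) :&: E v|)
        < N * k ^ k.-1 * #|avoid (T :\ v)|.
  rewrite mulnA -(mulnA N) -expnSr prednK //.
  by apply: leq_ltn_trans bad _; rewrite ltn_pmul2r.
rewrite ltn_pmul2l // => lt_bad.
rewrite -(setD1K vT) -(ltn_add2l #|avoid (T :\ v) :&: E v|) addn0.
by rewrite -card_avoidU1; apply: leq_ltn_trans lt_bad; rewrite leq_pmull.
Qed.

End LocalLemma.

(** * Resampling one color *)

Section Resample.
Variables (V C : finType).
Implicit Types (x : {ffun V -> C}) (v : V) (c : C).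

Definition recolor v x c : {ffun V -> C} :=
  [ffun w => if w == v then c else x w].

Lemma recolor_recolor v x c d : recolor v (recolor v x c) d = recolor v x d.
Proof. by apply/ffunP=> w; rewrite !ffunE; case: eqP. Qed.

Lemma recolor_id v x : recolor v x (x v) = x.
Proof. by apply/ffunP=> w; rewrite ffunE; case: eqP => [->|]. Qed.

Lemma recolor_at v x c : recolor v x c v = c.
Proof. by rewrite ffunE eqxx. Qed.

(** Changing the color of [v] to [c] while recording the old one loses no
    information, and lands in the pairs of an element [y] of [A] and one of
    the at most [m] elements of [K y]. *)
Lemma card_resample v (A : {set {ffun V -> C}}) (K : {ffun V -> C} -> {set C})
    m :
  (forall x c, x \in A -> recolor v x c \in A) ->
  (forall x c, K (recolor v x c) = K x) -> (forall x, #|K x| <= m) ->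
  #|C| * #|A :&: [set x : {ffun V -> C} | x v \in K x]| <= m * #|A|.
Proof.
move=> A_inv K_inv K_le.
set B := A :&: _.
pose move_color (p : C * {ffun V -> C}) := (recolor v p.2 p.1, p.2 v).
pose P := [set p : {ffun V -> C} * C | (p.1 \in A) && (p.2 \in K p.1)].
have inj : injective move_color.
  move=> [c x] [d y] /= /pair_equal_spec[eq_rec eq_v].
  have -> : c = d by rewrite -(recolor_at v x c) eq_rec recolor_at.
  by rewrite -(recolor_id v x) -(recolor_recolor v x c) eq_rec eq_v
             recolor_recolor recolor_id.
have -> : #|C| * #|B| = #|move_color @: setX [set: C] B|.
  by rewrite card_imset // cardsX cardsT.
apply: (@leq_trans #|P|).
  apply/subset_leq_card/subsetP=> p /imsetP[[c x] /setXP[_]].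
  by rewrite !inE /= => /andP[xA xK] ->; rewrite A_inv //= K_inv.
rewrite -sum1dep_card.
rewrite -(pair_big_dep (mem A) (fun x c => c \in K x) (fun _ _ => 1)) /=.
rewrite mulnC -sum_nat_const; apply: leq_sum => x _.
by rewrite sum1_card.
Qed.

End Resample.

(** * Fooling the low-degree vertices *)

Section Fooling.
Variables (G : sgraph) (S : {set G}) (q N : nat) (leqN : q <= N).
Variable f : {ffun G -> {ffun coloring G N -> 'I_N}}.
Hypothesis f_local : is_strategy f.

Definition overlay (x : coloring G N) (z : coloring (induced S) q) :
    coloring G N :=
  [ffun w => if insub w is Some s then widen_ord leqN (z s) else x w].

Lemma overlay_in x z (s : induced S) : overlay x z (val s) = widen_ord leqN (z s).
Proof. by rewrite ffunE valK. Qed.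

Lemma overlay_out x z w : w \notin S -> overlay x z w = x w.
Proof. by move=> wS; rewrite ffunE insubN. Qed.

Lemma strategyP v (x y : coloring G N) :
  (forall w, adj v w -> x w = y w) -> f v x = f v y.
Proof.
move=> xy; move/forallP/(_ v)/forallP/(_ x)/forallP/(_ y)/implyP: f_local => h.
by apply/eqP/h/forallP=> w; apply/implyP=> /xy/eqP.
Qed.

Definition guesses v (x : coloring G N) : {set 'I_N} :=
  [set f v (overlay x z) | z : coloring (induced S) q].

Lemma guesses_recolor u v x c :
  ~~ adj v u -> guesses v (recolor u x c) = guesses v x.
Proof.
move=> nvu; apply: eq_imset => z; apply: strategyP => w vw.
rewrite !ffunE; case: insubP => // _.
by case: eqVneq vw nvu => [->|//] ->.
Qed.

(** Only the colors seen by [v] matter, so the colorings of [S] may be assumed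
    to take a default color [c] away from the neighbors of [v]. *)
Lemma card_guesses v x (c : 'I_q) : #|guesses v x| <= q ^ degree v.
Proof.
pose D := [pred s : induced S | adj v (val s)].
pose F := pffun_on c D (mem 'I_q).
have sub : guesses v x \subset [set f v (overlay x z) | z in F].
  apply/subsetP=> _ /imsetP[z _ ->].
  apply/imsetP; exists [ffun s => if s \in D then z s else c].
    apply/pffun_onP; split=> //; apply/subsetP=> s.
    by rewrite inE ffunE; case: (s \in D) => //; rewrite eqxx.
  apply: strategyP => w vw; rewrite !ffunE; case: insubP => // s _ ws.
  by rewrite ffunE inE ws vw.
apply: leq_trans (subset_leq_card sub) _.
apply: leq_trans (leq_imset_card _ _) _.
rewrite card_pffun_on card_ord leq_pexp2l //; first exact: leq_ltn_trans (ltn_ord c).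
rewrite /degree -(card_imset _ val_inj); apply/subset_leq_card/subsetP.
by move=> _ /imsetP[s vs ->]; rewrite inE.
Qed.

(** A vertex that is safe for [x] is wrong for every coloring of [S], and the
    restriction of [f] to [S] is a strategy with [q] colors once [x] is fixed;
    guesses outside of the [q] colors can only fail, so replacing them by a
    default color [c] does not hurt the strategy. *)
Lemma fool_all (x : coloring G N) (c : 'I_q) :
  ~~ solvable (induced S) q ->
  (forall v, v \notin S -> x v \notin guesses v x) ->
  exists y : coloring G N, forall v, f v y != y v.
Proof.
move=> unsolvable safe.
pose g : {ffun induced S -> {ffun coloring (induced S) q -> 'I_q}} :=
  [ffun s : induced S => [ffun z : coloring (induced S) q =>
     odflt c (insub (val (f (val s) (overlay x z))))]].
have g_local : is_strategy g.
  apply/forallP=> s; apply/forallP=> z; apply/forallP=> t; apply/implyP=> zt.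
  rewrite !ffunE; suff -> : f (val s) (overlay x z) = f (val s) (overlay x t) by [].
  apply: strategyP => w sw; rewrite !ffunE; case: insubP => // u _ uw.
  move/forallP/(_ u)/implyP: zt => zt; congr widen_ord; apply/eqP/zt.
  by rewrite /= /induced_adj /= uw.
have [z z_fools] : exists z, forall s, g s z != z s.
  move: unsolvable; rewrite negb_exists => /forallP/(_ g).
  rewrite g_local /= negb_forall => /existsP[z]; rewrite negb_exists => /forallP zP.
  by exists z.
exists (overlay x z) => v; case: (boolP (v \in S)) => [vS | vS].
  have -> : v = val (exist _ v vS : induced S) by [].
  rewrite overlay_in; apply: contra (z_fools (exist _ v vS)) => /eqP fz.
  by rewrite !ffunE fz /= valK.
rewrite overlay_out //; apply: contra (safe v vS) => /eqP <-.
exact: imset_f.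
Qed.

End Fooling.

(** An event of [unsafe] is determined by the colors of its vertex and of the
    neighbors, while resampling a single color bounds its probability
    whatever the other colors are: hence the dependency graph is G itself,
    rather than its square as in the plain local lemma. *)
Lemma not_solvable_of_high_degree (G : sgraph) k q N :
  0 < k -> 0 < q -> q ^ k * k.+1 ^ k < N * k ^ k.-1 ->
  ~~ solvable (induced [set v : G | k < degree v]) q -> ~~ solvable G N.
Proof.
move=> k_gt0 q_gt0 threshold unsolvable.
set S := [set v : G | k < degree v] in unsolvable.
have leqN : q <= N.
  have le_pow : k ^ k.-1 <= k.+1 ^ k.
    by apply: (@leq_trans (k ^ k)); rewrite ?leq_exp2r // leq_pexp2l // leq_pred.
  have qk : q <= q ^ k by rewrite -{1}(expn1 q) leq_pexp2l.
  have k_pow : 0 < k ^ k.-1 by rewrite expn_gt0 k_gt0.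
  rewrite -(leq_pmul2r k_pow); apply: leq_trans (ltnW threshold).
  exact: leq_mul.
have N_gt0 : 0 < N by apply: leq_trans leqN.
pose c : 'I_q := Ordinal q_gt0.
rewrite negb_exists; apply/forallP=> f; rewrite negb_and -implybE.
apply/implyP=> f_local.
pose unsafe v := [set x : coloring G N | x v \in guesses S leqN f v x].
have [|||| v B |  | x /avoidP x_safe] :=
    @lopsided_local_lemma _ G unsafe (@adj G) (~: S) k (q ^ k) N.
- exact: adj_sym.
- move=> v; rewrite !inE -leqNgt => dv; apply: leq_trans dv.
  exact/subset_leq_card/subsetIr.
- exact: k_gt0.
- exact: threshold.
- move=> vS _ vB far; rewrite -[in X in X * _](card_ord N).
  apply: card_resample => [y d /avoidP yB | y d | y].
  + apply/avoidP=> w wB; have := yB w wB; rewrite !inE.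
    rewrite guesses_recolor // 1?adj_sym ?far // ffunE.
    by case: eqVneq wB vB => [-> -> //|].
  + by rewrite guesses_recolor ?adj_irrefl.
  + apply: leq_trans (card_guesses S leqN f_local v y c) _.
    by rewrite leq_pexp2l //; move: vS; rewrite !inE -leqNgt.
- by rewrite card_ffun card_ord expn_gt0 N_gt0.
have [|y y_fools] := fool_all (leqN := leqN) f_local (x := x) c unsolvable.
  by move=> v vS; have := x_safe v; rewrite in_setC => /(_ vS); rewrite inE.
rewrite negb_forall; apply/existsP; exists y.
by rewrite negb_exists; apply/forallP.
Qed.

(** * The numerical bound *)

Local Open Scope ring_scope.
Import Order.TTheory GRing.Theory Num.Theory.

(** The base of the logarithm enters through 1 + t < exp t at t = 1 / k, raised
    to the power k. *)
Lemma threshold_of_expR (R : realType) (k q N : nat) :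
  (0 < k)%N -> (0 < q)%N -> expR 1 * k%:R ^+ 2 * q%:R ^+ k <= N%:R :> R ->
  (q ^ k * k.+1 ^ k < N * k ^ k.-1)%N.
Proof.
move=> k_gt0 q_gt0 le_N.
have k_pos : 0 < k%:R :> R by rewrite ltr0n.
have lt_e : (k.+1%:R / k%:R) ^+ k < expR 1 :> R.
  have -> : expR 1 = expR k%:R^-1 ^+ k :> R.
    by rewrite -expRM_natl mulfV ?gt_eqF.
  rewrite ltrXn2r -?lt0n ?divr_ge0 ?expR_ge0 //.
  rewrite -natr1 mulrDl divff ?gt_eqF // mul1r.
  by apply: expR_gt1Dx; rewrite invr_neq0 ?gt_eqF.
have lt_pow : k.+1%:R ^+ k < expR 1 * k%:R ^+ k :> R.
  by rewrite -ltr_pdivrMr ?exprn_gt0 // -expr_div_n.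
rewrite -(ltr_nat R) !natrM !natrX.
apply: (@lt_le_trans _ _ (expR 1 * k%:R * q%:R ^+ k * k%:R ^+ k.-1)).
  have -> : expR 1 * k%:R * q%:R ^+ k * k%:R ^+ k.-1
            = q%:R ^+ k * (expR 1 * k%:R ^+ k) :> R.
    have -> : k%:R ^+ k = k%:R * k%:R ^+ k.-1 :> R by rewrite -exprS prednK.
    by rewrite -!mulrA [RHS]mulrCA; congr (_ * _); rewrite mulrCA.
  by rewrite ltr_pM2l // exprn_gt0 // ltr0n.
rewrite ler_wpM2r ?exprn_ge0 //; apply: le_trans le_N.
rewrite ler_wpM2r ?exprn_ge0 // ler_wpM2l ?expR_ge0 //.
by rewrite expr2 ler_peMl // ler1n.
Qed.

Theorem corollary1p7 (R : realType) (k q : nat) (G : sgraph)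
    (k_gt0 : (0 < k)%N) (q_gt0 : (0 < q)%N) (G_gt0 : (0 < #|G|)%N) :
  ~~ solvable (induced [set v : G | (k < degree v)%N]) q ->
  (HG G_gt0)%:R < expR 1 * k%:R ^+ 2 * q%:R ^+ k :> R.
Proof.
move=> unsolvable; rewrite ltNge; apply/negP => le_HG.
have [_ HG_solvable _] := HGP G_gt0.
have threshold := threshold_of_expR k_gt0 q_gt0 le_HG.
have /negP := not_solvable_of_high_degree k_gt0 q_gt0 threshold unsolvable.
exact.
Qed.
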